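(* Let $n\ge 1$, let $\Sigma$ be a finite set and fix a total order $<$ on $\Sigma$. Then the edge labeling $\lambda$ of $\Pi_{n,\Sigma}$ described below is an EL-labeling of $\Pi_{n,\Sigma}$.
   Context: Let $[n]=\{1,\dots,n\}$ and $[[n]]=\{1,\bar 1,\dots,n,\bar n\}$ with the involution $i\leftrightarrow\bar i$; for $X\subseteq[[n]]$ put $\bar X=\{\bar x:x\in X\}$. A $\Sigma$-labeled partition of $[[n]]$ is a set partition $\pi$ of $[[n]]$ together with a subset $T\subseteq\pi$ of ''signed'' blocks and an injective map $f:T\to\Sigma$, such that (i) for every block $R\in\pi$ also $\bar R\in\pi$, and (ii) a block $S$ satisfies $S=\bar S$ if and only if $S$ is signed. Let $\Sigma(\pi)=f(T)$; for $\sigma\in\Sigma(\pi)$ let $\pi_\sigma$ be the block with sign $\sigma$, and put $\pi_\sigma=\emptyset$ if $\sigma\notin\Sigma(\pi)$. Unsigned blocks come in pairs $R\neq\bar R$. Order: $\pi\preceq\psi$ iff (a) $\pi_\sigma\subseteq\psi_\sigma$ for every $\sigma\in\Sigma(\pi)$, and (b) for every unsigned block $R$ of $\pi$ there is a block $T$ of $\psi$ with $R\subseteq T$ and $\bar R\subseteq\bar T$. $\Pi_{n,\Sigma}$ is the poset of all $\Sigma$-labeled partitions of $[[n]]$ with a new maximum $\hat 1$ adjoined; its minimum $\hat 0$ is the partition into singletons. It is ranked with $\mathrm{rk}(\pi)=n-k$ ($k$ = number of pairs of unsigned blocks) and $\mathrm{rk}(\hat 1)=n+1$. The labeling $\lambda$: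 for a block $R$, its representative $r(R)$ is the least $i\in[n]$ with $i\in R$ or $\bar i\in R$; $R$ is normalized if $r(R)\in R$. For a cover $x\prec\!\cdot\, y$ with $y\neq\hat 1$, exactly one of the following holds: there is $\sigma\in\Sigma$ with $x_\sigma\subsetneq y_\sigma$ (edge of sign $\sigma$); or $R\cup R'\in y$ for distinct normalized unsigned blocks $R,R'$ of $x$ (coherent edge); or $R\cup\bar{R'}\in y$ for distinct normalized unsigned blocks $R,R'$ of $x$ (non-coherent edge). Set $\lambda=(0,\max(r(R),r(R')))$ for a coherent edge, $\lambda=(2,\min(r(R),r(R')))$ for a non-coherent edge; for an edge of sign $\sigma$, $\lambda=(1,|\{\tau\in\Sigma(x):\tau\le\sigma\}|)$ if $\sigma\in\Sigma(x)$ and $\lambda=(1,|\{\tau\in\Sigma:\tau\le\sigma\}\cup\Sigma(x)|)$ if $\sigma\notin\Sigma(x)$; and $\lambda(x\prec\!\cdot\,\hat 1)=(1,2)$. Labels are pairs of integers ordered lexicographically. EL-labeling: for a bounded poset, an edge labeling (of covering relations) such that each closed interval $[x,y]$ has a unique maximal chain whose label word is strictly increasing, and this chain's word lexicographically precedes the words of all other maximal chains of $[x,y]$. *)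

(* Defs.v *)
From HB Require Import structures.
From mathcomp Require Import all_boot all_order.

Set Implicit Arguments.
Unset Strict Implicit.
Unset Printing Implicit Defensive.

Import Order.TTheory.

Section EdgeLabelings.

Context {dP dL : Order.disp_t} {P : finTBPOrderType dP} {L : orderType dL}.

Definition covers (x y : P) : bool :=
  (x < y)%O && ~~ [exists z : P, (x < z)%O && (z < y)%O].

(* As P is finite, the maximal chains of [x, y] are the sequences
   x = c_0 <. c_1 <. ... <. c_k = y of covers; such a chain is represented by
   c = [:: c_1; ...; c_k]. *)
Definition maximal_chain (x y : P) (c : seq P) : bool :=
  path covers x c && (last x c == y).

(* lambda x y is only ever used at pairs with x <. y. *)
Definition label_word (lambda : P -> P -> L) (x : P) (c : seq P) : seq L :=
  pairmap lambda x c.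

Definition EL_labeling (lambda : P -> P -> L) : Prop :=
  forall x y : P, (x <= y)%O ->
  exists c : seq P,
    [/\ maximal_chain x y c,
        sorted <%O (label_word lambda x c),
        (forall c' : seq P, maximal_chain x y c' ->
           sorted <%O (label_word lambda x c') -> c' = c)
      & (forall c' : seq P, maximal_chain x y c' -> c' <> c ->
           ((label_word lambda x c : seqlexi L)
              < (label_word lambda x c' : seqlexi L))%O)].

End EdgeLabelings.

Section LabeledPartitions.

Variables (n : nat) (d : Order.disp_t) (Sigma : finOrderType d).

(* [[n]]: for i : 'I_n, (i, false) stands for the element i + 1 of [n] and
   (i, true) for its bar. *)
Definition dbl : finType := ('I_n * bool)%type.

Definition bar (x : dbl) : dbl := (x.1, ~~ x.2).

Definition barset (X : {set dbl}) : {set dbl} := [set bar x | x in X].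

(* The partial map f : T -> Sigma is encoded as a total function to
   option Sigma, with T the set of S such that f S is not None. *)
Definition is_lpart (p : {set {set dbl}} * {ffun {set dbl} -> option Sigma})
    : bool :=
  [&& partition p.1 [set: dbl],
      [forall S : {set dbl}, (p.2 S : bool) ==> (S \in p.1)],
      [forall S : {set dbl}, forall S' : {set dbl},
         [&& p.2 S : bool, p.2 S' : bool & p.2 S == p.2 S'] ==> (S == S')],
      [forall R in p.1, barset R \in p.1]
    & [forall S in p.1, (S == barset S) == p.2 S]].

Record lpart := LPart {
  lpart_val : {set {set dbl}} * {ffun {set dbl} -> option Sigma};
  lpartP : is_lpart lpart_val }.

HB.instance Definition _ := [isSub for lpart_val].
HB.instance Definition _ := [Finite of lpart by <:].

Implicit Types p q : lpart.

Definition blocks p : {set {set dbl}} := (val p).1.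
Definition sgn p : {set dbl} -> option Sigma := (val p).2.

Definition unsigned p : {set {set dbl}} :=
  [set R in blocks p | sgn p R == None].

Definition signs p : {set Sigma} :=
  [set s | [exists S in blocks p, sgn p S == Some s]].

Definition sblock p (s : Sigma) : {set dbl} :=
  odflt set0 [pick S in blocks p | sgn p S == Some s].

Definition lpart_le p q : bool :=
  [forall s in signs p, sblock p s \subset sblock q s] &&
  [forall R in unsigned p,
     [exists T in blocks q, (R \subset T) && (barset R \subset barset T)]].

Lemma barK : involutive bar.
Proof. by case=> i b; rewrite /bar /= negbK. Qed.

Lemma blocks_partition p : partition (blocks p) [set: dbl].
Proof. by case: p => -[B f] pP; case/and5P: (pP). Qed.

Lemma sgn_inj p S S' s : sgn p S = Some s -> sgn p S' = Some s -> S = S'.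
Proof.
case: p => -[B f] /= pP; case/and5P: (pP) => _ _ /forallP/= h _ _.
rewrite /sgn /= => e1 e2.
by move/forallP: (h S) => /(_ S'); rewrite e1 e2 eqxx /= => /eqP.
Qed.

Lemma sblockE p S s : S \in blocks p -> sgn p S = Some s -> sblock p s = S.
Proof.
rewrite /sblock => SB eS; case: pickP => [S' /andP[_ /eqP e] | /(_ S)] /=.
  exact: sgn_inj e eS.
by rewrite SB eS eqxx.
Qed.

Lemma signsP p s :
  reflect (exists2 S, S \in blocks p & sgn p S = Some s) (s \in signs p).
Proof.
rewrite inE; apply: (iffP exists_inP) => -[S SB /eqP e]; exists S => //.
Qed.

Lemma sblock_out p s : s \notin signs p -> sblock p s = set0.
Proof.
move=> h; rewrite /sblock; case: pickP => //= S /andP[SB /eqP e].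
by case/signsP: h; exists S.
Qed.

Lemma block_neq0 p S : S \in blocks p -> S != set0.
Proof.
move=> SB; apply: contraTneq SB => ->.
by case/and3P: (blocks_partition p).
Qed.

Lemma block_eq p S S' x :
  S \in blocks p -> S' \in blocks p -> x \in S -> x \in S' -> S = S'.
Proof.
case/and3P: (blocks_partition p) => _ tI _ SB S'B xS xS'.
by rewrite -(def_pblock tI SB xS) -(def_pblock tI S'B xS').
Qed.

Lemma unsignedP p R : reflect (R \in blocks p /\ sgn p R = None) (R \in unsigned p).
Proof. by rewrite inE; apply: (iffP andP) => -[? /eqP]. Qed.

Lemma sblock_in p s : s \in signs p ->
  sblock p s \in blocks p /\ sgn p (sblock p s) = Some s.
Proof. by case/signsP=> S SB e; rewrite (sblockE SB e). Qed.

Lemma lpart_leP p q :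
  reflect ((forall s, s \in signs p -> sblock p s \subset sblock q s) /\
           (forall R, R \in unsigned p ->
              exists2 T, T \in blocks q & R \subset T))
          (lpart_le p q).
Proof.
apply: (iffP andP) => -[h1 h2]; split.
- by move=> s; move/forall_inP: h1; apply.
- move=> R; move/forall_inP: h2 => /[apply] /exists_inP[T TB /andP[? _]].
  by exists T.
- exact/forall_inP.
- apply/forall_inP => R /h2 [T TB RT]; apply/exists_inP; exists T => //.
  by rewrite RT imsetS.
Qed.

Lemma lpart_le_sign p q s : lpart_le p q -> s \in signs p -> s \in signs q.
Proof.
case/lpart_leP=> h _ sp; apply/negPn/negP => /sblock_out e.
move: (h s sp); rewrite e subset0 => /eqP e0.
by case: (sblock_in sp) => /block_neq0; rewrite e0 eqxx.
Qed.

Lemma lpart_le_block p q R : lpart_le p q -> R \in blocks p ->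
  exists2 T, T \in blocks q & R \subset T.
Proof.
move=> le RB; case/lpart_leP: (le) => h1 h2.
case e: (sgn p R) => [s|]; last by apply: h2; apply/unsignedP.
have sp : s \in signs p by apply/signsP; exists R.
exists (sblock q s); first by case: (sblock_in (lpart_le_sign le sp)).
by rewrite -(sblockE RB e) h1.
Qed.

Lemma lpart_le_refl : reflexive lpart_le.
Proof.
move=> p; apply/lpart_leP; split=> // R /unsignedP[RB _].
by exists R.
Qed.

Lemma lpart_le_trans : transitive lpart_le.
Proof.
move=> q p r pq qr; apply/lpart_leP; split=> [s sp | R /unsignedP[RB _]].
  case/lpart_leP: (pq) => h _; case/lpart_leP: (qr) => h' _.
  exact: subset_trans (h s sp) (h' s (lpart_le_sign pq sp)).
have [T TB RT] := lpart_le_block pq RB.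
have [U UB TU] := lpart_le_block qr TB.
by exists U => //; apply: subset_trans RT TU.
Qed.

Lemma lpart_le_blocks_anti p q R :
  lpart_le p q -> lpart_le q p -> R \in blocks p -> R \in blocks q.
Proof.
move=> pq qp RB; have [T TB RT] := lpart_le_block pq RB.
have [U UB TU] := lpart_le_block qp TB.
have /set0Pn[x xR] := block_neq0 RB.
have eRU : R = U.
  exact: (block_eq RB UB xR (subsetP TU x (subsetP RT x xR))).
suff -> : R = T by [].
by apply/eqP; rewrite eqEsubset RT eRU TU.
Qed.

Lemma sgn_blocks p S s : sgn p S = Some s -> S \in blocks p.
Proof.
case: p => -[B f] /= pP; case/and5P: (pP) => _ /forallP/= /(_ S) h _ _ _.
by rewrite /sgn /blocks /= => e; move: h; rewrite e.
Qed.

Lemma lpart_le_sgn_anti p q S s :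
  lpart_le p q -> lpart_le q p -> sgn p S = Some s -> sgn q S = Some s.
Proof.
move=> pq qp e; have SB := sgn_blocks e.
have sp : s \in signs p by apply/signsP; exists S.
have [_ e'] := sblock_in (lpart_le_sign pq sp).
case/lpart_leP: (pq) => /(_ s sp) h1 _.
case/lpart_leP: (qp) => /(_ s (lpart_le_sign pq sp)) h2 _.
suff <- : sblock q s = S by [].
by rewrite -(sblockE SB e); apply/eqP; rewrite eqEsubset h1 h2.
Qed.

Lemma lpart_le_anti : antisymmetric lpart_le.
Proof.
move=> p q /andP[pq qp]; apply: val_inj.
have eB : blocks p = blocks q.
  by apply/setP=> R; apply/idP/idP; apply: lpart_le_blocks_anti.
have ef : sgn p =1 sgn q.
  move=> S; case e: (sgn p S) => [s|]; first by rewrite (lpart_le_sgn_anti pq qp e).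
  by case e': (sgn q S) => [s|] //; rewrite (lpart_le_sgn_anti qp pq e') in e.
move: eB ef; rewrite /blocks /sgn.
by case: (val p) (val q) => [B f] [B' f'] /= -> /ffunP ->.
Qed.

Definition lpart0_val : {set {set dbl}} * {ffun {set dbl} -> option Sigma} :=
  ([set [set x] | x in [set: dbl]], [ffun => None]).

Lemma barset1 x : barset [set x] = [set bar x].
Proof. exact: imset_set1. Qed.

Lemma bar_neq x : bar x != x.
Proof. by case: x => i b; rewrite /bar xpair_eqE /= eqxx; case: b. Qed.

Lemma lpart0_subproof : is_lpart lpart0_val.
Proof.
apply/and5P; split=> /=.
- apply/and3P; split.
  + apply/eqP/setP => x; rewrite inE; apply/bigcupP.
    by exists [set x]; [apply: imset_f | rewrite inE].
  + apply/trivIsetP => _ _ /imsetP[x _ ->] /imsetP[y _ ->] xy.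
    by rewrite disjoints1 inE; apply: contraNneq xy => ->.
  + by apply/imsetP => -[x _ /setP/(_ x)]; rewrite !inE eqxx.
- by apply/forallP => S; rewrite ffunE.
- by apply/forallP => S; apply/forallP => S'; rewrite !ffunE.
- by apply/forall_inP => _ /imsetP[x _ ->]; rewrite barset1 imset_f.
- apply/forall_inP => _ /imsetP[x _ ->]; rewrite barset1 ffunE /=.
  by rewrite (inj_eq set1_inj) [x == _]eq_sym (negbTE (bar_neq x)).
Qed.

Definition lpart0 : lpart := LPart lpart0_subproof.

Lemma lpart_le0 p : lpart_le lpart0 p.
Proof.
apply/lpart_leP; split=> [s /signsP[S _] | R /unsignedP[/imsetP[x _ ->] _]].
  by rewrite /sgn /= ffunE.
have xc : x \in cover (blocks p) by rewrite (cover_partition (blocks_partition p)).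
by exists (pblock (blocks p) x); rewrite ?pblock_mem // sub1set mem_pblock.
Qed.

(* Pi_{n, Sigma}; None is the adjoined maximum. *)
Definition PiPoset : Type := option lpart.

HB.instance Definition _ := Finite.on PiPoset.

Definition Pi_le (x y : PiPoset) : bool :=
  match x, y with
  | _, None => true
  | None, Some _ => false
  | Some p, Some q => lpart_le p q
  end.

Lemma Pi_le_refl : reflexive Pi_le.
Proof. by case=> //= p; apply: lpart_le_refl. Qed.

Lemma Pi_le_anti : antisymmetric Pi_le.
Proof. by case=> [p|] [q|] //= /lpart_le_anti ->. Qed.

Lemma Pi_le_trans : transitive Pi_le.
Proof. by case=> [q|] [p|] [r|] //=; apply: lpart_le_trans. Qed.

HB.instance Definition _ :=
  Order.Le_isPOrder.Build (Order.Disp tt tt) PiPoset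
    Pi_le_refl Pi_le_anti Pi_le_trans.

Lemma Pi_le0x (x : PiPoset) : (Some lpart0 <= x :> PiPoset)%O.
Proof. by case: x => // p; apply: lpart_le0. Qed.

Lemma Pi_lex1 (x : PiPoset) : (x <= None :> PiPoset)%O.
Proof. by case: x. Qed.

HB.instance Definition _ := Order.hasBottom.Build _ PiPoset Pi_le0x.
HB.instance Definition _ := Order.hasTop.Build _ PiPoset Pi_lex1.

(* The i in [n] such that i or bar i lies in R. *)
Definition abs_support (R : {set dbl}) : {set 'I_n} :=
  [set i | ((i, false) \in R) || ((i, true) \in R)].

Definition least (R : {set dbl}) : option 'I_n :=
  [pick i in abs_support R | [forall j in abs_support R, (i <= j)%N]].

(* The shift turns the index i : 'I_n into the element i + 1 of {1, ..., n};
   0 is the junk value at R = set0. *)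
Definition block_repr (R : {set dbl}) : nat :=
  if least R is Some i then i.+1 else 0.

Definition normalized (R : {set dbl}) : bool :=
  if least R is Some i then (i, false) \in R else false.

Definition sign_edge p q (s : Sigma) : bool := sblock p s \proper sblock q s.

Definition nupair p (RR : {set dbl} * {set dbl}) : bool :=
  [&& RR.1 \in unsigned p, RR.2 \in unsigned p,
      normalized RR.1, normalized RR.2 & RR.1 != RR.2].

Definition coherent_edge p q (RR : {set dbl} * {set dbl}) : bool :=
  nupair p RR && (RR.1 :|: RR.2 \in blocks q).

Definition noncoherent_edge p q (RR : {set dbl} * {set dbl}) : bool :=
  nupair p RR && (RR.1 :|: barset RR.2 \in blocks q).

Definition sign_label p (s : Sigma) : nat :=
  if s \in signs p then #|[set t in signs p | (t <= s)%O]|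
  else #|[set t | (t <= s)%O] :|: signs p|.

(* On a cover exactly one of the three kinds of edges occurs; the sign is
   unique, and so is the pair (R, R') up to a swap, which leaves the labels
   unchanged. The value (0, 0) is junk, never reached on a cover. *)
Definition lambda (x y : PiPoset) : (nat *l nat)%type :=
  match x, y with
  | Some p, Some q =>
      if [pick s | sign_edge p q s] is Some s then (1, sign_label p s)
      else if [pick RR | coherent_edge p q RR] is Some RR then
        (0, maxn (block_repr RR.1) (block_repr RR.2))
      else if [pick RR | noncoherent_edge p q RR] is Some RR then
        (2, minn (block_repr RR.1) (block_repr RR.2))
      else (0, 0)
  | Some _, None => (1, 2)
  | None, _ => (0, 0)
  end.

End LabeledPartitions.

(* Main.v *)
Require Import Defs.
From mathcomp Require Import all_boot all_order.
From mathcomp Require Import zify.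

(** A Sigma-labeled partition [p] is encoded by the map [cd p] that sends an
    element of [[n]] to the sign of its block if that block is signed, and to
    the element of least absolute value of its block otherwise. Extending the
    code by the identity on signs, [p <= q] means that the code of [q] absorbs
    that of [p]. The covers of [p] then become substitutions: a representative
    [b] is replaced either by a sign or by [(a, g)] with [a < b] another
    representative, [g] telling whether the merge is non-coherent.

    An edge labeling is an EL-labeling as soon as every interval [[x, y]] with
    [x < y] has an atom [m] such that: the label of [x <. m] is strictly less
    than the labels of all other atoms; every atom of [[m, y]] has a larger
    label still; and for every other atom [z], some atom of [[z, y]] has a label
    at most that of [x <. z]. In terms of substitutions these three conditions
    amount to a short case analysis on the least substitution. *)

Set Implicit Arguments.
Unset Strict Implicit.
Unset Printing Implicit Defensive.

Import Order.TTheory.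

(** * A local criterion for EL-labelings *)

Section LocalCriterion.

Context {dP dL : Order.disp_t} {P : finTBPOrderType dP} {L : orderType dL}.
Variable lambda : P -> P -> L.

Definition atom (x y z : P) : bool := covers x z && (z <= y)%O.

Definition least_atom (x y m : P) : Prop :=
  [/\ atom x y m,
      forall z, atom x y z -> z <> m -> (lambda x m < lambda x z)%O,
      forall w, atom m y w -> (lambda x m < lambda m w)%O
    & forall z, atom x y z -> z <> m ->
        exists2 w, atom z y w & (lambda z w <= lambda x z)%O].

Lemma covers_lt (x y : P) : covers x y -> (x < y)%O.
Proof. by case/andP. Qed.

Lemma chain_le (x y : P) c : maximal_chain x y c -> (x <= y)%O.
Proof.
rewrite /maximal_chain; elim: c x => [|z c IH] x /=; first by move/eqP->.
case/andP=> /andP[/covers_lt/ltW xz pc] l; apply: le_trans xz _.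
by apply: IH; rewrite pc.
Qed.

Lemma chain_cons (x y z : P) c :
  maximal_chain x y (z :: c) = covers x z && maximal_chain z y c.
Proof. by rewrite /maximal_chain /= andbA. Qed.

Lemma chain_atom (x y z : P) c :
  maximal_chain x y (z :: c) -> atom x y z.
Proof. by rewrite chain_cons /atom => /andP[-> /chain_le]. Qed.

Lemma chain_refl (x : P) c : maximal_chain x x c -> c = [::].
Proof.
case: c => // z c; rewrite chain_cons => /andP[/covers_lt xz /chain_le zx].
by have := lt_le_trans xz zx; rewrite ltxx.
Qed.

(** Induction on the size of the half-open interval above [x] up to [y]; the chain is [m] followed
    by the chain of [[m, y]]. The third clause of [least_atom] makes its word increasing, the second
    makes it lexicographically first, and the fourth rules out an increasing chain through another
    atom. *)
Lemma EL_of_least_atoms :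
  (forall x y : P, (x < y)%O -> exists m, least_atom x y m) ->
  EL_labeling lambda.
Proof.
move=> H x y.
have [k] := ubnP #|[set z | (x < z)%O && (z <= y)%O]|.
elim: k x => // k IH x leN.
rewrite le_eqVlt => /orP[/eqP <-|xy].
  exists [::]; split=> //.
  - by rewrite /maximal_chain /=.
  - by move=> c' /chain_refl.
  - by move=> c' /chain_refl.
have IHz z : (x < z)%O -> (z <= y)%O -> exists c : seq P,
    [/\ maximal_chain z y c, sorted <%O (label_word lambda z c),
        (forall c' : seq P, maximal_chain z y c' ->
           sorted <%O (label_word lambda z c') -> c' = c)
      & (forall c' : seq P, maximal_chain z y c' -> c' <> c ->
           ((label_word lambda z c : seqlexi L)
              < (label_word lambda z c' : seqlexi L))%O)].
  move=> xz zy; apply: IH => //.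
  rewrite ltnS in leN; apply: leq_trans leN; apply/proper_card/properP; split.
    apply/subsetP=> w; rewrite !inE => /andP[zw ->].
    by rewrite (lt_trans xz zw).
  by exists z; rewrite inE ?xz ?zy ?ltxx.
have [m [am mmin minc mdec]] := H x y xy.
have /andP[xm my] := am.
have [c0 [c0ch c0s c0u c0l]] := IHz m (covers_lt xm) my.
exists (m :: c0); split.
- by rewrite chain_cons xm.
- case: c0 c0ch c0s {c0u c0l} => //= w c0 /chain_atom aw.
  by rewrite minc.
- case=> [|z c1]; first by rewrite /maximal_chain /= => /eqP e;
    rewrite e ltxx in xy.
  move=> ch; have az := chain_atom ch.
  have [e|/eqP zm] := eqVneq z m.
    rewrite e /= => /path_sorted s; congr cons; apply: c0u s.
    by move: ch; rewrite e chain_cons => /andP[].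
  move: ch; rewrite chain_cons => /andP[_ ch1] s.
  have /andP[/covers_lt xz zy] := az.
  have [cz [_ _ czu czl]] := IHz z xz zy.
  have e1 : c1 = cz by apply: czu ch1 _; move: s => /= /path_sorted.
  have [w /andP[zw wy] lw] := mdec z az zm.
  have [cw [cwch _ _ _]] := IHz w (lt_trans xz (covers_lt zw)) wy.
  have wch : maximal_chain z y (w :: cw) by rewrite chain_cons zw.
  suff : False by [].
  case: c1 e1 ch1 s => [|u c1] e1 ch1 /=.
    by move: ch1; rewrite /maximal_chain /= => /eqP e; rewrite -e in wch;
      have := chain_refl wch.
  (* The increasing tail [u :: c1] is the lexicographically first chain of [[z, y]], so its first
     label is at most that of [w], hence at most that of [x <. z], against the increase at [z]. *)
  case/andP=> lu _; suff /le_trans/(_ lw) : (lambda z u <= lambda z w)%O.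
    by rewrite leNgt lu.
  have [e|/eqP ne] := eqVneq (w :: cw) cz; first by move: e;
    rewrite -e1 => -[->].
  have /= := czl _ wch ne; rewrite -e1 /=.
  by move/ltW; rewrite lexi_cons; case/andP.
- case=> [|z c1]; first by rewrite /maximal_chain /= => /eqP e;
    rewrite e ltxx in xy.
  move=> ch ne; have az := chain_atom ch.
  rewrite /= ltxi_cons.
  have [e|/eqP zm] := eqVneq z m; last first.
    have h := mmin z az zm; rewrite (ltW h) /=.
    by rewrite leNgt h.
  rewrite e lexx /=; apply: c0l => [|e1]; last by apply: ne; rewrite e e1.
  by move: ch; rewrite e chain_cons => /andP[].
Qed.

End LocalCriterion.

(** * Ranks of signs *)

Section SignRank.

Variables (d : Order.disp_t) (Sigma : finOrderType d).
Implicit Types (A : {set Sigma}) (s t : Sigma).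

(* The down-set of [s] for the total order that lists [A] first, then its
   complement, so that sign labels are ranks in this order. *)
Definition down A s : {set Sigma} :=
  if s \in A then [set t in A | (t <= s)%O] else [set t | (t <= s)%O] :|: A.

Lemma mem_down A s : s \in down A s.
Proof. by rewrite /down; case: ifP => sA; rewrite !inE ?sA lexx. Qed.

Lemma down_trans A s t : t \in down A s -> down A t \subset down A s.
Proof.
rewrite /down; case: (boolP (s \in A)) => sA.
  rewrite inE => /andP[tA ts]; rewrite tA; apply/subsetP=> u.
  by rewrite !inE => /andP[-> /le_trans->].
rewrite !inE; case: (boolP (t \in A)) => tA; rewrite ?orbF => ts;
  apply/subsetP=> u.
  by rewrite !inE => /andP[-> _]; rewrite orbT.
by rewrite !inE => /orP[/le_trans->|->] //; rewrite orbT.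
Qed.

Lemma down_total A s t : (s \in down A t) || (t \in down A s).
Proof.
rewrite /down; case: (boolP (s \in A)); case: (boolP (t \in A)) => // tA sA;
  rewrite !inE ?sA ?tA ?orbT //=.
  exact: le_total.
by rewrite (negbTE sA) (negbTE tA) !orbF le_total.
Qed.

Lemma down_anti A s t : s \in down A t -> t \in down A s -> s = t.
Proof.
rewrite /down; case: (boolP (s \in A)); case: (boolP (t \in A)) => // tA sA;
  rewrite !inE ?sA ?tA ?(negbTE sA) ?(negbTE tA) //= ?orbF => h1 h2.
  by apply/le_anti; rewrite h1.
by apply/le_anti; rewrite h1.
Qed.

(** Down-sets are initial segments of a total order: they are nested, and their sizes order the
    signs. *)
Lemma card_down_lt A s t : (#|down A s| < #|down A t|) = (t \notin down A s).
Proof.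
apply/idP/idP => [lt|ts].
  by apply: contraL lt => /down_trans/subset_leq_card; rewrite -leqNgt.
have st : s \in down A t by have := down_total A s t; rewrite (negbTE ts) orbF.
apply/proper_card/properP; split; first exact: down_trans.
by exists t => //; apply: mem_down.
Qed.

Lemma card_down_inj A : injective (fun s => #|down A s|).
Proof.
move=> s t /= e; apply: (@down_anti A).
  by apply/negPn; rewrite -card_down_lt e ltnn.
by apply/negPn; rewrite -card_down_lt e ltnn.
Qed.

Lemma card_down_gt0 A s : 0 < #|down A s|.
Proof. by apply/card_gt0P; exists s; apply: mem_down. Qed.

(** Once [s] is in [A], only members of [A] up to [s] are counted: using the same sign twice in a
    row does not raise the label. *)
Lemma down_setU1_self A s : #|down (s |: A) s| <= #|down A s|.
Proof.
apply/subset_leq_card/subsetP=> t; rewrite /down setU11.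
case: (boolP (s \in A)) => sA; rewrite !inE => /andP[tA ts].
  by rewrite ts andbT; case/orP: tA => // /eqP->.
by rewrite ts.
Qed.

(** The down-set of [s] gains at most [s'], and all the rest of it already precedes [s']. So using
    the later sign first gives no ascent. *)
Lemma down_setU1_le A s s' :
  #|down A s| < #|down A s'| -> #|down (s' |: A) s| <= #|down A s'|.
Proof.
rewrite card_down_lt => h; apply/subset_leq_card/subsetP=> t.
have s's : s' != s by apply: contraNneq h => ->; apply: mem_down.
move: h; rewrite /down !inE [s == s']eq_sym (negbTE s's) /=.
case: (boolP (s \in A)); case: (boolP (s' \in A)) => s'A sA;
  rewrite !inE ?s'A ?(negbTE s'A) ?orbT //=.
- rewrite -ltNge => ss' /andP[/orP[/eqP-> _|-> /le_trans->//]]; last exact: ltW.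
  by rewrite s'A lexx.
- by move=> _ /andP[/orP[/eqP->|->]]; rewrite ?lexx ?orbT.
- rewrite orbF -ltNge => /ltW ss' /or3P[/le_trans->//|/eqP->|->];
    rewrite ?lexx ?orbT //.
Qed.

(** The down-set of [s'] already contains [s] and does not change when [s] joins [A]. So using the
    earlier sign first gives an ascent. *)
Lemma down_setU1_lt A s s' :
  #|down A s| < #|down A s'| -> #|down A s| < #|down (s |: A) s'|.
Proof.
rewrite card_down_lt => h.
have s's : s' != s by apply: contraNneq h => ->; apply: mem_down.
suff /eqP-> : down (s |: A) s' == down A s' by rewrite card_down_lt.
move: h; rewrite /down !inE (negbTE s's) /=.
case: (boolP (s \in A)) => sA.
  by rewrite (setUidPr _) ?sub1set // eqxx.
case: (boolP (s' \in A)) => s'A;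
  rewrite !inE ?s'A ?(negbTE s'A) ?orbT ?orbF // -ltNge => ss'.
have -> : [set t | (t <= s')%O] :|: (s |: A) = [set t | (t <= s')%O] :|: A.
  apply/setP=> t; rewrite !inE; case: eqP => [->|//]; by rewrite (ltW ss').
exact: eqxx.
Qed.

(** The first sign of the order has rank 1, just below the second component of the label [(1, 2)] of
    edges to the top; [s] witnesses that there is a sign. *)
Lemma card_down_eq1 A s : exists t, #|down A t| = 1.
Proof.
have [m _ mmin] := @arg_minnP _ s xpredT (fun t => #|down A t|) isT.
exists m; apply/eqP/cards1P; exists m; apply/setP=> t; rewrite !inE.
apply/idP/eqP=> [tm|->]; last exact: mem_down.
apply: (@down_anti A) => //; apply/negPn; rewrite -card_down_lt -leqNgt;
  exact: mmin.
Qed.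

End SignRank.

(** * Codes of labeled partitions *)

Section Codes.

Variables (n : nat) (d : Order.disp_t) (Sigma : finOrderType d).
Local Notation dbl := (dbl n).
Local Notation lpart := (lpart n Sigma).
Implicit Types (p q : lpart) (x y z : dbl) (s t : Sigma).

Definition value : finType := (Sigma + dbl)%type.
Implicit Types v w : value.

(** Signs are fixed because signed blocks are their own bars. *)
Definition vbar v : value := if v is inr x then inr (bar x) else v.

Lemma vbarK : involutive vbar.
Proof. by case=> //= x; rewrite barK. Qed.

Lemma vbar_inj : injective vbar. Proof. exact: can_inj vbarK. Qed.

Lemma mem_barset (R : {set dbl}) x : (x \in barset R) = (bar x \in R).
Proof. by rewrite -{1}[x]barK (mem_imset _ _ (can_inj (@barK n))). Qed.

Lemma bar_cases x y : x.1 = y.1 -> x = y \/ x = bar y.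
Proof. by case: x y => i [] [j []] /= ->; rewrite /bar /=; auto. Qed.

Definition block p x : {set dbl} := pblock (blocks p) x.

Lemma block_in p x : block p x \in blocks p.
Proof. by rewrite pblock_mem // (cover_partition (blocks_partition p)). Qed.

Lemma mem_block p x : x \in block p x.
Proof. by rewrite mem_pblock (cover_partition (blocks_partition p)). Qed.

Lemma blockE p R x : R \in blocks p -> x \in R -> R = block p x.
Proof. by move=> RB xR; apply: block_eq RB (block_in p x) xR (mem_block p x).
  Qed.

Lemma blocksP p R : R \in blocks p -> exists x, R = block p x.
Proof.
by move=> RB; have /set0Pn[x xR] := block_neq0 RB; exists x; apply: blockE.
Qed.

Lemma block_same p x y : y \in block p x -> block p y = block p x.
Proof. by move=> yx; rewrite -(blockE (block_in p x) yx). Qed.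

Lemma barset_block p x : barset (block p x) = block p (bar x).
Proof.
apply: blockE; last by rewrite mem_barset barK mem_block.
case: p => -[B f] pP; case/and5P: (pP) => _ _ _ /forall_inP h _.
by apply: h; apply: block_in (LPart pP) x.
Qed.

Lemma sgn_block p x : (sgn p (block p x) : bool) = (bar x \in block p x).
Proof.
have -> : (sgn p (block p x) : bool) = (block p x == barset (block p x)).
  have RB := block_in p x; move: RB; set R := block p x.
  case: p @R => -[B f] pP R; case/and5P: (pP) => _ _ _ _ /forall_inP h RB.
  by rewrite (eqP (h _ RB)).
rewrite barset_block; apply/eqP/idP=> [->|h]; first exact: mem_block.
by rewrite (block_same h).
Qed.

(* The default [inr x] is never reached. *)
Definition cd p x : value :=
  if sgn p (block p x) is Some s then inl s
  else if [pick y in block p x | [forall z in block p x, y.1 <= z.1]] is Some y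
       then inr y else inr x.

Lemma block_least p x :
  exists y, (y \in block p x) && [forall z in block p x, y.1 <= z.1].
Proof.
have [m mR mmin] := @arg_minnP _ x (fun z => z \in block p x)
  (fun z : dbl => val z.1) (mem_block p x).
by exists m; rewrite mR; apply/forall_inP.
Qed.

Variant cd_spec p x : value -> Prop :=
  | CdSigned s of sgn p (block p x) = Some s : cd_spec p x (inl s)
  | CdUnsigned y of sgn p (block p x) = None & y \in block p x
      & (forall z, z \in block p x -> y.1 <= z.1) : cd_spec p x (inr y).

Lemma cdP p x : cd_spec p x (cd p x).
Proof.
rewrite /cd; case e: (sgn _ _) => [s|]; first by constructor.
case: pickP => [y /andP[yR /forall_inP ymin]|h]; first by constructor.
by have [y] := block_least p x; rewrite h.
Qed.

(** A sign belongs to one block only and a representative lies in its block, so codes separate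
    blocks. *)
Lemma cd_eqE p x y : (cd p x == cd p y) = (y \in block p x).
Proof.
apply/eqP/idP=> [|h]; last first.
  rewrite /cd (block_same h); case: (sgn _ _) => //; case: pickP => // h0.
  by have [z] := block_least p x; rewrite h0.
case: (cdP p x) => [s e|z e zx _]; case: (cdP p y) => [s' e'|z' e' zy _] //.
  by case=> es; rewrite -es in e'; rewrite (sgn_inj e e') mem_block.
case=> ez; rewrite -ez in zy; rewrite -(block_same zx) (block_same zy).
exact: mem_block.
Qed.

Lemma cd_block p x : block p x = [set z | cd p z == cd p x].
Proof. by apply/setP=> z; rewrite inE eq_sym cd_eqE. Qed.

(** The representatives of an unsigned block and of its bar have the same absolute value, so they
    are equal or bars of each other; equality would put an element and its bar in one unsigned
    block. *)
Lemma cd_bar p x : cd p (bar x) = vbar (cd p x).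
Proof.
have sE : bar x \in block p x = (x \in block p (bar x)).
  by rewrite -barset_block mem_barset.
case: (cdP p x) => [s e|y e yx ymin] /=.
  have h : bar x \in block p x by rewrite -sgn_block e.
  by rewrite /cd (block_same h) e.
have h : bar x \notin block p x by rewrite -sgn_block e.
case: (cdP p (bar x)) => [s e'|z e' zx zmin].
  by move: h; rewrite sE -{1}[x]barK -sgn_block e'.
congr inr.
have zx' : bar z \in block p x by rewrite -mem_barset barset_block.
have yx' : bar y \in block p (bar x) by rewrite -barset_block mem_barset barK.
have := zmin _ yx'; have := ymin _ zx'; rewrite /= => le1 le2.
have /bar_cases[ezy|//] : z.1 = y.1 by apply/val_inj/anti_leq; rewrite le1 le2.
rewrite ezy -(block_same yx) -sgn_block in zx'.
by rewrite (block_same yx) e in zx'.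
Qed.

Lemma cd_mem p x y : cd p x = inr y -> y \in block p x.
Proof. by case: (cdP p x) => // z _ zx _ [<-]. Qed.

Lemma cd_root p x y : cd p x = inr y -> cd p y = inr y.
Proof. by move=> e; rewrite -e; apply/esym/eqP; rewrite cd_eqE (cd_mem e). Qed.

Lemma cd_le p x y : cd p x = inr y -> y.1 <= x.1.
Proof. by case: (cdP p x) => // z e zx zmin [<-];
  apply: zmin (mem_block p x). Qed.


Lemma cd_sgn p x s : (sgn p (block p x) == Some s) = (cd p x == inl s).
Proof. by case: (cdP p x) => [t ->|y ->]. Qed.

(** The properties [cd_bar], [cd_root] and [cd_le], which turn out to characterize codes. *)
Definition is_code (c : dbl -> value) : Prop :=
  [/\ forall x, c (bar x) = vbar (c x),
      forall x y, c x = inr y -> c y = inr y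
    & forall x y, c x = inr y -> y.1 <= x.1].

(** * Realization of codes by labeled partitions *)

Section OfCode.

Variables (c : dbl -> value) (cC : is_code c).

Let fiber (v : value) : {set dbl} := [set z | c z == v].

(** The fiber of an absent sign is empty; the guard [S != set0] keeps the empty set, which is no
    block, from receiving that sign. *)
Definition code_val : {set {set dbl}} * {ffun {set dbl} -> option Sigma} :=
  ([set fiber (c x) | x in [set: dbl]],
   [ffun S : {set dbl} => [pick s | (S == fiber (inl s)) && (S != set0)]]).

Lemma code_sgn x s : (code_val.2 (fiber (c x)) == Some s) = (c x == inl s).
Proof.
have xx : x \in fiber (c x) by rewrite inE.
have n0 : fiber (c x) != set0 by apply/set0Pn; exists x.
rewrite ffunE; case: pickP => [t /andP[/eqP e _]|h].
  by move: xx; rewrite e inE => /eqP->; apply/eqP/eqP=> -[->].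
by apply/esym/negP=> /eqP e; have := h s; rewrite n0 e eqxx.
Qed.

Lemma code_sgn_bool x : (code_val.2 (fiber (c x)) : bool) = (c (bar x) == c x).
Proof.
case: cC => cb cr _; rewrite cb.
case e: (code_val.2 _) => [s|].
  by have /eqP := e; rewrite code_sgn => /eqP ->; rewrite eqxx.
case e': (c x) => [s|y] /=.
  by have := code_sgn x s; rewrite e e' eqxx.
apply/esym/negP=> /eqP[ey]; have := bar_neq y; by rewrite ey eqxx.
Qed.

Lemma code_bar v : barset (fiber v) = fiber (vbar v).
Proof.
case: cC => cb _ _; apply/setP=> x; rewrite mem_barset !inE cb.
by rewrite -{1}[v]vbarK (inj_eq vbar_inj).
Qed.

Lemma code_is_lpart : is_lpart code_val.
Proof.
have [cb cr cl] := cC.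
apply/and5P; split.
- apply/and3P; split.
  + apply/eqP/setP => x; rewrite inE; apply/bigcupP.
    by exists (fiber (c x)); [apply: imset_f | rewrite inE].
  + apply/trivIsetP => _ _ /imsetP[x _ ->] /imsetP[y _ ->] xy.
    apply/pred0P=> z /=; rewrite !inE; apply: contraNF xy.
    by case/andP=> /eqP<- /eqP<-.
  + by apply/imsetP => -[x _ /setP/(_ x)]; rewrite !inE eqxx.
- apply/forallP => S; apply/implyP; rewrite /= ffunE.
  case: pickP => // s /andP[/eqP e /set0Pn[x xS]] _.
  by move: xS; rewrite e inE => /eqP<-; apply: imset_f.
- apply/forallP => S; apply/forallP => S'; apply/implyP => /and3P[] /=.
  rewrite !ffunE; case: pickP => // s /andP[/eqP-> _] _.
  by case: pickP => // s' /andP[/eqP-> _] _ /eqP[->].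
- apply/forall_inP => _ /imsetP[x _ ->].
  by rewrite code_bar -cb; apply: imset_f.
- apply/forall_inP => _ /imsetP[x _ ->]; rewrite code_sgn_bool code_bar -cb.
  apply/eqP; apply/eqP/eqP => [/setP/(_ x)|->//].
  by rewrite !inE eqxx => /esym/eqP.
Qed.

Lemma code_surj : exists p, cd p =1 c.
Proof.
have [cb cr cl] := cC.
pose p := LPart code_is_lpart; exists p => x.
have bE : block p x = fiber (c x).
  by apply/esym/blockE; [apply: imset_f | rewrite inE].
have sE s : (sgn p (block p x) == Some s) = (c x == inl s).
  by rewrite bE -code_sgn.
case: (cdP p x) => [s e|y e yx ymin].
  by have := sE s; rewrite e eqxx => /esym/eqP.
case ex: (c x) => [s|z]; first by have := sE s; rewrite e ex eqxx.
congr inr; move: yx; rewrite bE ex inE => /eqP cy.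
have zx : z \in block p x by rewrite bE ex inE (cr _ _ ex).
(* Both elements are least in the fiber; they cannot be bars of each other, as [c] sends [z] to
   itself and [bar z] to [bar z]. *)
have /bar_cases[//|eyz] : y.1 = z.1.
  by apply/val_inj/anti_leq; rewrite (ymin _ zx) (cl _ _ cy).
move: cy; rewrite eyz cb (cr _ _ ex) => -[] /esym eb.
by have := bar_neq z; rewrite -eb eqxx.
Qed.

End OfCode.

(** * The order in terms of codes *)

Definition ex p v : value := if v is inr x then cd p x else v.

Lemma ex_bar p v : ex p (vbar v) = vbar (ex p v).
Proof. by case: v => //= x; rewrite cd_bar. Qed.

Lemma ex_cd p x : ex p (cd p x) = cd p x.
Proof. by case e: (cd p x) => //=; apply: cd_root e. Qed.

Lemma signsE p s : (s \in signs p) = [exists x, cd p x == inl s].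
Proof.
apply/signsP/existsP=> [[S /blocksP[x ->] e]|[x e]].
  by exists x; rewrite -cd_sgn e.
by exists (block p x); [apply: block_in | apply/eqP; rewrite cd_sgn].
Qed.

Lemma sblock_cd p s : sblock p s = [set z | cd p z == inl s].
Proof.
have [|h] := boolP (s \in signs p); last first.
  rewrite sblock_out //; apply/setP=> z; rewrite !inE; apply/esym/negP=> e.
  by case/negP: h; rewrite signsE; apply/existsP; exists z.
rewrite signsE => /existsP[x /eqP e]; rewrite -e -cd_block; apply: sblockE.
  exact: block_in.
by apply/eqP; rewrite cd_sgn e.
Qed.

(** A block of [p] lies in one block of [q] as soon as [q] gives each of its elements the value of
    their common code in [p]. *)
Lemma lpart_leE p q : reflect (forall x, ex q (cd p x) = cd q x) (lpart_le p q).
Proof.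
apply: (iffP idP) => [le x|h].
  case e: (cd p x) => [s|y] /=.
    case/lpart_leP: (le) => /(_ s) h _; apply/esym/eqP.
    have : x \in sblock p s by rewrite sblock_cd inE e.
    have sp : s \in signs p by rewrite signsE; apply/existsP; exists x;
      apply/eqP.
    by move/(subsetP (h sp)); rewrite sblock_cd inE.
  have [T TB RT] := lpart_le_block le (block_in p x).
  have yT := subsetP RT _ (cd_mem e); have xT := subsetP RT _ (mem_block p x).
  by apply/eqP; rewrite cd_eqE -(blockE TB yT).
apply/lpart_leP; split=> [s _|R /unsignedP[/blocksP[x ->] _]].
  apply/subsetP=> x; rewrite !sblock_cd !inE => /eqP e.
  by rewrite -h e.
exists (block q x); first exact: block_in.
apply/subsetP=> z; rewrite -!cd_eqE => /eqP e.
by rewrite -(h z) -(h x) e.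
Qed.

Lemma cd_inj p q : cd p =1 cd q -> p = q.
Proof.
move=> e; apply: lpart_le_anti; apply/andP; split; apply/lpart_leE=> x.
  by rewrite e ex_cd.
by rewrite -e ex_cd.
Qed.

End Codes.

(** * Covers as substitutions *)

Section Moves.

Variables (n : nat) (d : Order.disp_t) (Sigma : finOrderType d).
Local Notation dbl := (dbl n).
Local Notation lpart := (lpart n Sigma).
Local Notation value := (value n Sigma).
Implicit Types (p q : lpart) (x y z : dbl) (s t : Sigma) (v w : value).
Implicit Types a b i j : 'I_n.

(** There is one root for each pair of unsigned blocks, so roots keep track of the rank. *)
Definition isroot p j : bool := cd p (j, false) == inr (j, false).

Definition vact (g : bool) v : value := if g then vbar v else v.

(** Replacing [(b, true)] by [vbar v] along with [(b, false)] by [v] keeps the map compatible with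
    bars. *)
Definition vsub b v w : value :=
  if w is inr x then if x.1 == b then vact x.2 v else w else w.

(** The inequality [x.1 < b] makes [x] the representative of the merged block. *)
Definition valid p b v : bool :=
  isroot p b && (if v is inr x then isroot p x.1 && (x.1 < b) else true).

Lemma vact_bar g v : vact (~~ g) v = vbar (vact g v).
Proof. by case: g => //=; rewrite vbarK. Qed.

Lemma ex_vact p g v : ex p (vact g v) = vact g (ex p v).
Proof. by case: g => //=; rewrite ex_bar. Qed.

Lemma vact_inr g j : vact g (inr (j, false)) = inr (j, g) :> value.
Proof. by case: g. Qed.

Lemma cd_vact p j g : cd p (j, g) = vact g (cd p (j, false)).
Proof. by have := ex_vact p g (inr (j, false)); rewrite vact_inr. Qed.

Lemma cd_isroot p x : isroot p x.1 -> cd p x = inr x.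
Proof. by case: x => j g /eqP /= e; rewrite cd_vact e vact_inr. Qed.

Lemma isroot_cd p x y : cd p x = inr y -> isroot p y.1.
Proof.
case: y => j g /cd_root; rewrite cd_vact -vact_inr /isroot.
by case: g => [/(@vbar_inj _ _ _ (cd p (j, false)) (inr (j, false)))->|/= ->].
Qed.

Lemma vsub_code p b v : valid p b v -> is_code (fun x => vsub b v (cd p x)).
Proof.
move=> /andP[rb vv]; split=> [x|x y|x y].
- rewrite cd_bar; case: (cd p x) => [//|[j g]] /=.
  by case: ifP => _ //; rewrite vact_bar.
- case e: (cd p x) => [//|z] /=; case: ifP => zb.
    case: v vv => [s|w] vv; first by rewrite /vact; case: (z.2).
    case/andP: vv => rw wb ey.
    have e1 : y.1 = w.1 by move: ey; rewrite /vact; case: (z.2) => -[<-].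
    rewrite cd_isroot ?e1 //= e1; case: eqP => // e2.
    by rewrite e2 ltnn in wb.
  by case=> <-; rewrite (cd_root e) /= zb.
- case e: (cd p x) => [//|z] /=; case: ifP => zb; last by case=> <-;
    apply: cd_le e.
  case: v vv => [s|w] vv; first by rewrite /vact; case: (z.2).
  case/andP: vv => rw wb ey.
  have -> : y.1 = w.1 by move: ey; rewrite /vact; case: (z.2) => -[<-].
  by rewrite (leq_trans (ltnW wb)) // -(eqP zb); apply: cd_le e.
Qed.

(* Equal to [p] when [valid p b v] fails. *)
Definition psub p b v : lpart :=
  odflt p [pick q : lpart | [forall x, cd q x == vsub b v (cd p x)]].

Lemma cd_psub p b v x : valid p b v -> cd (psub p b v) x = vsub b v (cd p x).
Proof.
move=> V; rewrite /psub; case: pickP => [q /forallP/(_ x)/eqP //|h].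
have [q qE] := code_surj (vsub_code V).
by have /negP[] := h q; apply/forallP=> z; rewrite qE.
Qed.

Lemma isroot_psub p b v j :
  valid p b v -> isroot (psub p b v) j = isroot p j && (j != b).
Proof.
move=> V; rewrite /isroot cd_psub //; apply/eqP/andP=> [|[/eqP e jb]];
  last first.
  by rewrite e /= (negbTE jb).
case e: (cd p (j, false)) => [//|y] /=.
have le := cd_le e; have ry := isroot_cd e; move: V => /andP[rb vv].
case: ifP => yb; last first.
  by case=> ey; rewrite ey; split=> //; move: yb; rewrite ey /= => ->.
case: v vv => [s|w]; first by rewrite /vact; case: (y.2).
case/andP=> rw wb ey.
have ej : w.1 = j by move: ey; rewrite /vact; case: (y.2) => -[e'];
  rewrite // -[w]barK e'.
by move: le wb; rewrite (eqP yb) ej /=; lia.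
Qed.

Lemma signs_psub p b v : valid p b v ->
  signs (psub p b v) = if v is inl s then s |: signs p else signs p.
Proof.
move=> V; have /andP[rb _] := V.
apply/setP=> t; rewrite signsE.
transitivity ((t \in signs p) || (v == inl t)); last first.
  by case: v {V} => [s|w]; rewrite ?orbF // in_setU1 orbC eq_sym.
rewrite signsE; apply/existsP/orP.
  case=> x; rewrite cd_psub //; case e: (cd p x) => [s|y] /=.
    by move=> h; left; apply/existsP; exists x; rewrite e.
  by case: ifP => // _ h; right; case: v {V} h => [s|w]; rewrite /vact;
    case: (y.2).
case=> [/existsP[x /eqP e]|/eqP e]; first by exists x; rewrite cd_psub // e.
by exists (b, false); rewrite cd_psub // cd_isroot //= eqxx e.
Qed.

Lemma ex_vsub p b v w : ex p (inr (b, false)) = ex p v ->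
  ex p (vsub b v w) = ex p w.
Proof.
move=> h; case: w => [//|[j g]] /=; case: eqP => //= ->.
by rewrite ex_vact -h /= -cd_vact.
Qed.

(** The substitution adds the single identification of [b] with [v], up to bars. *)
Lemma psub_le p q b v : valid p b v -> lpart_le p q ->
  lpart_le (psub p b v) q = (ex q (inr (b, false)) == ex q v).
Proof.
move=> V /lpart_leE le; apply/lpart_leE/eqP=> [h|h x].
  have := h (b, false); rewrite cd_psub // cd_isroot /= ?eqxx //.
  by case/andP: V.
by rewrite cd_psub // ex_vsub // le.
Qed.

Lemma le_psub p b v : valid p b v -> lpart_le p (psub p b v).
Proof.
move=> V; apply/lpart_leE=> x; rewrite cd_psub //.
case e: (cd p x) => [//|y] /=.
by rewrite cd_psub // (cd_root e).
Qed.

Lemma isroot_le p q j : lpart_le p q -> isroot q j -> isroot p j.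
Proof.
move=> /lpart_leE le rj; have := le (j, false).
rewrite (@cd_isroot q (j, false)) //.
case e: (cd p (j, false)) => [//|y] /= e'.
have h1 := cd_le e; have h2 := cd_le e'.
have -> : j = y.1 by apply/val_inj/anti_leq; rewrite h1 h2.
exact: isroot_cd e.
Qed.

(** The element codes of [p] sit over roots of [p], and [q] fixes the elements over its own roots.
    Hence a strict increase loses a root. *)
Lemma eq_of_isroot p q :
  lpart_le p q -> (forall j, isroot p j -> isroot q j) -> p = q.
Proof.
move=> /lpart_leE le h; apply: cd_inj => x; rewrite -le.
case e: (cd p x) => [//|y] /=.
by rewrite cd_isroot // h // (isroot_cd e).
Qed.

Lemma psub_neq p b v : valid p b v -> psub p b v != p.
Proof.
move=> V; apply/eqP=> e; have := isroot_psub b V.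
by rewrite e eqxx andbF; case/andP: V => ->.
Qed.

(** Take for [b] a root of [p] that [q] loses, and for [v] the code of [b] in [q]. *)
Lemma exists_move p q : lpart_le p q -> p != q ->
  exists b v, valid p b v /\ ex q (inr (b, false)) = ex q v.
Proof.
move=> le ne.
have [b /andP[rb nb]] : exists b, isroot p b && ~~ isroot q b.
  apply/existsP; apply: contraNT ne => /existsPn h;
    apply/eqP/eq_of_isroot => // j rj.
  by have := h j; rewrite rj negbK.
exists b, (cd q (b, false)); split; last by rewrite ex_cd.
rewrite /valid rb /=; case e: (cd q (b, false)) => [//|y].
have ry := isroot_cd e; rewrite (isroot_le le) //=.
rewrite ltn_neqAle (cd_le e) andbT; apply: contraNneq nb => /val_inj /= <-.
exact: ry.
Qed.

Local Notation PiP := (PiPoset n Sigma).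

(* [Y = None] is the maximum, which imposes no constraint on merges. *)
Definition ok (Y : PiP) (u v : value) : bool :=
  if Y is Some q then ex q u == ex q v else true.

(** Roots only disappear upwards, and the two ends differ by the root [b] alone; whether [b] is a
    root of an intermediate element decides which end it equals. *)
Lemma covers_psub p b v : valid p b v ->
  covers (Some p : PiP) (Some (psub p b v)).
Proof.
move=> V; apply/andP; split.
  by rewrite lt_neqAle [(_ <= _)%O]le_psub // andbT eq_sym; apply: psub_neq.
apply/existsPn=> -[r|]; last first.
  by apply/negP=> /andP[_ /lt_le_trans/(_ (Pi_lex1 _))]; rewrite ltxx.
rewrite !lt_def; apply/negP => /andP[/andP[rp pr] /andP[qr rq]].
have hr j : isroot r j -> isroot p j by apply: isroot_le.
have hq j : isroot (psub p b v) j -> isroot r j by apply: isroot_le.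
have [rb|rb] := boolP (isroot r b).
  case/eqP: rp; congr Some; apply/esym/eq_of_isroot => // j rj.
  have [->//|jb] := eqVneq j b.
  by apply: hq; rewrite isroot_psub // rj.
case/eqP: qr; congr Some; apply/esym/eq_of_isroot => // j rj.
rewrite isroot_psub // hr //=; by apply: contraNneq rb => <-.
Qed.

(** By [exists_move] some substitution lies below any [r] strictly above [p], and a cover leaves no
    room for another element. The top covers [p] only when no substitution is valid. *)
Lemma atomP p (Y Z : PiP) : (Some p <= Y :> PiP)%O -> reflect
  ((exists b v, [/\ valid p b v, ok Y (inr (b, false)) v & Z = Some (psub p b
    v)]) \/
   [/\ Y = None, Z = None & forall b v, ~~ valid p b v])
  (atom (Some p : PiP) Y Z).
Proof.
move=> pY; apply: (iffP andP) => [[c ZY]|].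
- case: Z c ZY => [r|] c ZY.
    left; have /andP[pr noz] := c.
    have le : lpart_le p r := ltW pr.
    have ne : p != r by apply: contraTneq pr => ->; rewrite ltxx.
    have [b [v [V e]]] := exists_move le ne.
    have h : psub p b v = r.
      apply/eqP; apply: contraNT noz => ne2; apply/existsP;
        exists (Some (psub p b v)).
      case/andP: (covers_psub V) => -> _ /=; rewrite lt_neqAle; apply/andP;
        split=> //.
      by rewrite [(_ <= _)%O]psub_le // e.
    exists b, v; rewrite h; split=> //.
    case: Y pY ZY => [q|//] pq rq /=.
    by rewrite -(psub_le V) // h.
  have eY : Y = None by case: Y {pY} ZY.
  right; split=> // b v; apply/negP=> V.
  case/andP: c => _ /existsP; case; exists (Some (psub p b v)).
  by case/andP: (covers_psub V) => -> _.
- case=> [[b [v [V o ->]]]|[-> -> h]].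
    split; first exact: covers_psub.
    by case: Y pY o => [q|//] pq /=; rewrite -(psub_le V).
  split=> //; apply/andP; split=> //.
  apply/existsPn=> -[r|]; last by rewrite ltxx andbF.
  apply/negP=> /andP[pr _].
  have le : lpart_le p r := ltW pr.
  have ne : p != r by apply: contraTneq pr => ->; rewrite ltxx.
  have [b [v [V _]]] := exists_move le ne.
  by have := h b v; rewrite V.
Qed.

End Moves.

(** * Labels of substitutions *)

Section Labels.

Variables (n : nat) (d : Order.disp_t) (Sigma : finOrderType d).
Local Notation dbl := (dbl n).
Local Notation lpart := (lpart n Sigma).
Local Notation value := (value n Sigma).
Local Notation PiP := (PiPoset n Sigma).
Implicit Types (p q : lpart) (x y z : dbl) (s t : Sigma) (v w : value).
Implicit Types a b i j : 'I_n.

Definition fib p j (g : bool) : {set dbl} := [set z | cd p z == inr (j, g)].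

Lemma mem_fib p j g : isroot p j -> (j, g) \in fib p j g.
Proof. by move=> rj; rewrite inE cd_isroot. Qed.

Lemma least_fib p j g : isroot p j -> least (fib p j g) = Some j.
Proof.
move=> rj.
have jA : j \in abs_support (fib p j g).
  by rewrite inE; case: g; rewrite mem_fib ?orbT.
have jmin i : i \in abs_support (fib p j g) -> j <= i.
  by rewrite !inE => /orP[] /eqP/cd_le.
rewrite /least; case: pickP => [i /andP[iA /forall_inP imin]|/(_ j)].
  by congr Some; apply/val_inj/anti_leq; rewrite imin ?jmin.
by rewrite jA /= => /negbT/negP[]; apply/forall_inP.
Qed.

Lemma block_repr_fib p j g : isroot p j -> block_repr (fib p j g) = j.+1.
Proof. by move=> rj; rewrite /block_repr least_fib. Qed.

Lemma fib_block p j g : isroot p j -> fib p j g = block p (j, g).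
Proof. by move=> rj; rewrite cd_block cd_isroot. Qed.

Lemma barset_fib p j g : isroot p j -> barset (fib p j g) = fib p j (~~ g).
Proof. by move=> rj; rewrite !fib_block // barset_block. Qed.

(** Being normalized means that the representative carries no bar, whence the fiber at [false]. *)
Lemma normalized_unsigned p R : R \in unsigned p -> normalized R ->
  exists2 j, isroot p j & R = fib p j false.
Proof.
case/unsignedP=> /blocksP[x ->] /eqP sN.
case e: (cd p x) => [s|[j g]].
  by move: e => /eqP; rewrite -cd_sgn (eqP sN).
have rj : isroot p j := isroot_cd e.
have -> : block p x = fib p j g by rewrite cd_block e.
rewrite /normalized least_fib // inE cd_isroot // => /eqP[<-].
by exists j.
Qed.

Lemma fib_unsigned p j : isroot p j -> fib p j false \in unsigned p.
Proof.
move=> rj; apply/unsignedP; rewrite fib_block //; split; first exact: block_in.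
case e: (sgn _ _) => [s|//]; have /eqP := e.
by rewrite cd_sgn cd_isroot.
Qed.

Lemma nupair_fib p a b : isroot p a -> isroot p b -> a != b ->
  nupair p (fib p a false, fib p b false).
Proof.
move=> ra rb ab; rewrite /nupair /= !fib_unsigned //= /normalized !least_fib //.
rewrite !mem_fib //=; apply: contraNneq ab => /setP/(_ (a, false)).
by rewrite mem_fib // inE cd_isroot // => /esym/eqP[->].
Qed.

Lemma nupairP p R R' : nupair p (R, R') -> exists j j',
  [/\ isroot p j, isroot p j', j != j', R = fib p j false & R' = fib p j'
    false].
Proof.
case/and5P=> /= R1 R2 N1 N2 ne.
have [j rj e] := normalized_unsigned R1 N1;
  have [j' rj' e'] := normalized_unsigned R2 N2.
by exists j, j'; split=> //; apply: contraNneq ne => ej; rewrite e e' ej.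
Qed.

Lemma cd_same_block q R x y : R \in blocks q -> x \in R -> y \in R ->
  cd q x = cd q y.
Proof. by move=> RB xR yR; apply/eqP; rewrite cd_eqE -(blockE RB xR). Qed.

(** Recovers the merged pair and its coherence from the result, so that the choices made by [pick]
    in [lambda] do not matter. *)
Lemma vsub_root b a g j j' g' : a < b -> j != j' ->
  vsub b (inr (a, g)) (inr (j, false)) = vsub b (inr (a, g)) (inr (j', g')) :>
    value ->
  g' = g /\ ((j = a /\ j' = b) \/ (j = b /\ j' = a)).
Proof.
move=> ab jj' /=; case: eqP => [ej|nj]; case: eqP => [ej'|nj'].
- by rewrite ej ej' eqxx in jj'.
- by case=> -> ->; rewrite ej; auto.
- by rewrite /vact; case: g' => -[-> h]; rewrite ej'; auto; split; auto;
    move: h; case: g.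
- by case=> ejj; rewrite ejj eqxx in jj'.
Qed.

Lemma fib_psub p a b g : isroot p a -> isroot p b -> a < b ->
  fib p a false :|: fib p b g \in blocks (psub p b (inr (a, g))).
Proof.
move=> ra rb ab; have V : valid p b (inr (a, g)) by rewrite /valid rb ra.
set q := psub _ _ _.
suff -> : fib p a false :|: fib p b g = block q (a, false) by apply: block_in.
have nab : a == b = false by apply/negP=> /eqP e; rewrite e ltnn in ab.
rewrite cd_block; apply/setP=> z;
  rewrite !inE !cd_psub // (cd_isroot (p := p) (x := (a, false))) //= nab.
case: (cd p z) => [s|[j h]] //=; case: (eqVneq j b) => [->|jb].
  rewrite [inr _ == _ :> value](_ : _ = false) /=; last first.
    by apply/eqP=> -[e]; rewrite e eqxx in nab.
  by apply/eqP/eqP=> [[->]|]; rewrite /vact ?/bar; case: g {V q}; case: h.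
rewrite orbC [inr _ == _ :> value](_ : _ = false) //.
by apply/eqP=> -[e]; rewrite e eqxx in jb.
Qed.

(** As [a < b], the maximum in a coherent label is [b] and the minimum in a non-coherent one is [a];
    the successors account for numbering from 1. *)
Definition lab p b v : (nat *l nat)%type :=
  match v with
  | inl s => (1, sign_label p s)
  | inr (a, false) => (0, b.+1)
  | inr (a, true) => (2, a.+1)
  end.

Lemma sign_edge_psub p b v s : valid p b v ->
  sign_edge p (psub p b v) s = (v == inl s).
Proof.
move=> V; have /andP[rb _] := V; rewrite /sign_edge !sblock_cd.
have sub : [set z | cd p z == inl s] \subset [set z | cd (psub p b v) z == inl
  s].
  by apply/subsetP=> z; rewrite !inE cd_psub // => /eqP->.
apply/idP/eqP=> [/properP[_ [z]]|e].
  rewrite !inE cd_psub //; case e: (cd p z) => [t|y] /=; first by move=> ->.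
  by case: ifP => // _; case: v {V sub} => [t|w]; rewrite /vact;
    case: (y.2) => //= /eqP.
apply/properP; split=> //; exists (b, false); rewrite inE.
  by rewrite cd_psub // cd_isroot //= eqxx e.
by rewrite cd_isroot.
Qed.

Lemma lambda_psub p b v : valid p b v ->
  lambda (Some p : PiP) (Some (psub p b v)) = lab p b v.
Proof.
move=> V; rewrite /lambda; case: pickP => [s|nos].
  by rewrite sign_edge_psub // => /eqP ->.
case: v V nos => [s V /(_ s)|[a g] V _];
  first by rewrite sign_edge_psub // eqxx.
have /andP[rb /andP[/= ra ab]] := V.
have nab : a != b by apply: contraTneq ab => ->; rewrite ltnn.
(* A pair found by either [pick] is the merged one up to a swap, and its coherence is that of the
   merge. *)
have key R R' g' : nupair p (R, R') ->
    R :|: (if g' then barset R' else R') \in blocks (psub p b (inr (a, g))) ->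
  g' = g /\ (maxn (block_repr R) (block_repr R') = b.+1 /\
             minn (block_repr R) (block_repr R') = a.+1).
  case/nupairP=> j [j' [rj rj' jj' eR eR']].
  have -> : (if g' then barset R' else R') = fib p j' g'.
    by rewrite eR'; case: g' => //; rewrite barset_fib.
  move=> B; have : cd (psub p b (inr (a, g))) (j, false) = cd (psub p b (inr
    (a, g))) (j', g').
    by apply: (cd_same_block B); rewrite inE ?eR mem_fib ?orbT.
  rewrite !cd_psub // !cd_isroot // => /(vsub_root ab jj')[-> jE]; split=> //.
  by rewrite eR eR' !block_repr_fib //; case: jE => -[-> ->]; lia.
case: pickP => [[R R'] /andP[nu B]|noc].
  by have [<- [-> _]] := key R R' false nu B.
case: pickP => [[R R'] /andP[nu B]|non].
  by have [<- [_ ->]] := key R R' true nu B.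
(* The merged pair itself shows that the two searches cannot both fail. *)
have nu := nupair_fib ra rb nab; have B := fib_psub g ra rb ab.
case: g B {V key noc non} (noc (fib p a false, fib p b false)) (non (fib p a
  false, fib p b false)).
  by move=> B _; rewrite /noncoherent_edge nu /= barset_fib // B.
by move=> B; rewrite /coherent_edge nu /= B.
Qed.

End Labels.

(** * The least substitution below an element *)

Section LeastMove.

Variables (n : nat) (d : Order.disp_t) (Sigma : finOrderType d).
Local Notation lpart := (lpart n Sigma).
Local Notation value := (value n Sigma).
Local Notation PiP := (PiPoset n Sigma).
Local Notation natlex := (nat *l nat)%type.
Implicit Types (p q : lpart) (s t : Sigma) (u v w : value) (Y : PiP).
Implicit Types a b c i j : 'I_n.

Lemma ltlex (i k i' k' : nat) :
  (((i, k) : natlex) < ((i', k') : natlex))%O = (i < i') || (i == i') && (k <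
    k').
Proof. by rewrite ltxi_pair !leEnat ltEnat /=; lia. Qed.

Lemma lelex (i k i' k' : nat) :
  (((i, k) : natlex) <= ((i', k') : natlex))%O = (i < i') || (i == i') && (k <=
    k').
Proof. by rewrite lexi_pair !leEnat /=; lia. Qed.

Lemma sign_labelE p s : sign_label p s = #|down (signs p) s|.
Proof. by rewrite /sign_label /down; case: ifP. Qed.

Lemma ok_sym Y u v : ok Y u v -> ok Y v u.
Proof. by case: Y => //= q; rewrite eq_sym. Qed.

Lemma ok_trans Y u v w : ok Y u v -> ok Y v w -> ok Y u w.
Proof. by case: Y => //= q /eqP->. Qed.

Lemma ok_bar Y u v : ok Y u v -> ok Y (vbar u) (vbar v).
Proof. by case: Y => //= q /eqP e; rewrite !ex_bar e. Qed.

Definition root_val a : value := inr (a, false).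

Definition move Y p b v : bool := valid p b v && ok Y (root_val b) v.

Definition least_move Y p b v : Prop :=
  move Y p b v /\ forall b' v', move Y p b' v' -> (lab p b v <= lab p b' v')%O.

Lemma move_merge Y p a b g : isroot p a -> isroot p b -> a < b ->
  ok Y (root_val b) (inr (a, g)) -> move Y p b (inr (a, g)).
Proof. by move=> ra rb ab o; rewrite /move /valid ra rb ab. Qed.

Lemma move_sign Y p b s : isroot p b -> ok Y (root_val b) (inl s) ->
  move Y p b (inl s).
Proof. by move=> rb o; rewrite /move /valid rb. Qed.

(** Two different roots linked by [Y] without a bar would allow a coherent merge, whose label is too
    small. *)
Lemma no_coherent Y p b v : least_move Y p b v ->
  (forall k, ((0, k) : natlex) < lab p b v)%O ->
  forall a c, isroot p a -> isroot p c -> ok Y (root_val a) (root_val c) ->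
    a = c.
Proof.
move=> [_ mn] h a c ra rc o; apply/eqP; apply/negPn/negP => ac.
wlog {ac} lt : a c ra rc o / a < c.
  move=> W; have : (a < c) || (c < a) by rewrite -neq_ltn.
  by case/orP; [apply: W | apply: W => //; apply: ok_sym].
have /mn := move_merge ra rc lt (ok_sym o).
by rewrite leNgt h.
Qed.

(** Equal labels determine the sign, [a] or [b]. In the first two cases [no_coherent] gives the
    root; in the third, distinct [a] and [a'] could be merged coherently with a label below that of
    [b]. *)
Lemma least_move_uniq Y p b v b' v' : least_move Y p b v -> move Y p b' v' ->
  lab p b v = lab p b' v' -> b' = b /\ v' = v.
Proof.
move=> L M' e; have [M mn] := L.
have /andP[/andP[rb vv] o] := M; have /andP[/andP[rb' vv'] o'] := M'.
case: v e L M mn vv o => [s|[a []]] /=;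
  case: v' M' vv' o' => [s'|[a' []]] //= M' vv' o' e L M mn vv o.
- have es : s' = s.
    by case: e; rewrite !sign_labelE => /card_down_inj.
  rewrite es in o' *; split=> //.
  apply: (no_coherent L) => //.
  exact: ok_trans o' (ok_sym o).
- case: e => /val_inj ea; rewrite -ea in o' *; split=> //.
  apply: (no_coherent L) => //.
  exact: ok_trans o' (ok_sym o).
- case: e => /val_inj eb; rewrite -eb in o' vv' *; split=> //.
  case/andP: vv => ra ab; case/andP: vv' => ra' a'b.
  have oaa : ok Y (root_val a) (root_val a') := ok_trans (ok_sym o) o'.
  have [lt|lt|/val_inj->//] := ltngtP a a'.
    have /mn := move_merge ra ra' lt (ok_sym oaa).
    by rewrite lelex /=; lia.
  have /mn := move_merge ra' ra lt oaa.
  by rewrite lelex /=; lia.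
Qed.

Lemma psub_le_ok Y p b v : (Some p <= Y :> PiP)%O -> move Y p b v ->
  (Some (psub p b v) <= Y :> PiP)%O.
Proof.
by case: Y => // q pq /andP[V o]; rewrite [(_ <= _)%O]psub_le.
Qed.

(** A later substitution was already available in [p], with a strictly larger label by uniqueness.
    Only sign labels can change in between, and [down_setU1_lt] controls them. *)
Lemma least_move_increasing Y p b v W : (Some p <= Y :> PiP)%O ->
  least_move Y p b v ->
  atom (Some (psub p b v) : PiP) Y W ->
  (lab p b v < lambda (Some (psub p b v)) W)%O.
Proof.
move=> pY L; have [M mn] := L; have /andP[V o] := M.
case/(atomP _ (psub_le_ok pY M)) => [[b' [v' [V' o' ->]]]|[eY -> nov]].
  rewrite lambda_psub //.
  have VV : valid p b' v'.
    move: V' => /andP[]; rewrite isroot_psub // /valid => /andP[-> _].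
    by case: v' o' => //= x _ /andP[]; rewrite isroot_psub // => /andP[->].
  have M' : move Y p b' v' by rewrite /move VV.
  have b'b : b' <> b.
    by move=> e; case/andP: V'; rewrite isroot_psub // e eqxx andbF.
  have lt : (lab p b v < lab p b' v')%O.
    rewrite lt_neqAle mn // andbT; apply/eqP=> e.
    by case: (least_move_uniq L M' e).
  have sE := signs_psub V.
  case: v' {V' o' VV M'} lt => [s'|//]; case: v {L M mn V o} sE => [s|x] /= sE.
    rewrite !ltlex /= !sign_labelE sE; exact: down_setU1_lt.
  by rewrite /sign_label sE.
(* The next edge leads to the top. Merges are now unconstrained: a sign may be traded for the first
   one and a non-coherent merge for a coherent one, so the least label is at most [(1, 1)]. *)
rewrite eY {Y pY eY nov} /= in L M mn o *.
have /andP[rb vv] := V.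
case: v vv V L M mn o => [s|[a []]] vv V L M mn o /=; rewrite ltlex //=.
  have [t ht] := card_down_eq1 (signs p) s.
  have /mn : move None p b (inl t) by apply: move_sign.
  by rewrite lelex /= !sign_labelE ht; lia.
have /mn : move None p b (inr (a, false)) by case/andP: vv => ? ?;
  apply: move_merge.
by rewrite lelex.
Qed.

Lemma move_atom Y p b v (l : natlex) : (Some p <= Y :> PiP)%O ->
  move Y p b v -> (lab p b v <= l)%O ->
  exists2 W : PiP, atom (Some p : PiP) Y W & (lambda (Some p) W <= l)%O.
Proof.
move=> pY /andP[V o] le; exists (Some (psub p b v));
  last by rewrite lambda_psub.
by apply/atomP => //; left; exists b, v.
Qed.

(** A root linked to its own bar lies in a signed block of [Y], unless [Y] is the top. Then a sign
    edge, a coherent merge or the edge to the top is available, all with first component below 2. *)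
Lemma signed_atom Y p a k : (Some p <= Y :> PiP)%O -> isroot p a ->
  ok Y (root_val a) (inr (a, true)) ->
  exists2 W : PiP, atom (Some p : PiP) Y W &
    (lambda (Some p) W <= ((2, k) : natlex))%O.
Proof.
case: Y => [q|] pY ra o.
  case e: (cd q (a, false)) => [s|y].
    by apply: (move_atom pY (@move_sign _ _ a s _ _)); rewrite ?lelex //= e.
  by move: o; rewrite /= [cd q (a, true)]cd_vact e /= => /eqP[ey];
    have := bar_neq y; rewrite -ey eqxx.
have [s _|noS] := pickP (fun s : Sigma => true).
  by apply: (move_atom pY (@move_sign _ _ a s _ _)); rewrite ?lelex.
have [/existsP[b /existsP[[s|[c g]] V]]|nov] :=
  boolP [exists b, exists v, valid p b v].
- by have := noS s.
- case/andP: V => rb /andP[/= rc cb].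
  by apply: (move_atom pY (@move_merge _ _ c b false _ _ _ _)); rewrite ?lelex.
exists None; last by rewrite /= lelex.
apply/atomP => //; right; split=> // b v.
by move/existsPn: nov => /(_ b)/existsPn/(_ v).
Qed.

(** Usually the least substitution survives the other one ([keep]). It is lost only when [b'] is one
    of its roots, and then the links imposed by [Y] supply a replacement. *)
Lemma least_move_decreasing Y p b v b' v' : (Some p <= Y :> PiP)%O ->
  least_move Y p b v -> move Y p b' v' -> (lab p b v < lab p b' v')%O ->
  exists2 W : PiP, atom (Some (psub p b' v') : PiP) Y W &
    (lambda (Some (psub p b' v')) W <= lab p b' v')%O.
Proof.
move=> pY L M' lt; have [M mn] := L; have p'Y := psub_le_ok pY M'.
have /andP[V' o'] := M'; have /andP[rb' vv'] := V'.
have /andP[/andP[rb vv] o] := M.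
have rE j := isroot_psub j V'; have sE := signs_psub V'.
have keep : move Y (psub p b' v') b v ->
  (lab (psub p b' v') b v <= lab p b' v')%O ->
  exists2 W : PiP, atom (Some (psub p b' v') : PiP) Y W &
    (lambda (Some (psub p b' v')) W <= lab p b' v')%O by apply: move_atom.
case: v L M mn lt vv o keep => [s|[a []]] /= L M mn lt vv o keep.
- have [ebb|nbb] := eqVneq b b'; last first.
    apply: keep; first by apply: move_sign; rewrite // rE rb nbb.
    case: v' {M' p'Y V' o' rE} sE vv' lt => [s'|[a' []]] //= sE vv'.
    rewrite ltlex lelex /= !sign_labelE sE; exact: down_setU1_le.
  case: v' keep M' p'Y V' o' rE sE vv' lt =>
    [s'|[a' []]] //= _ M' p'Y V' o' rE sE vv' lt.
    (* A labeled partition cannot identify two different signs. *)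
    have eY : Y = None.
      have : ok Y (inl s) (inl s') by apply: ok_trans (ok_sym o) _; rewrite ebb.
      by case: (Y) => // q /eqP[e]; rewrite e ltxx in lt.
    have lt' : sign_label p s < sign_label p s' by move: lt; rewrite ltlex.
    have [/existsP[c rc]|nor] := boolP [exists c, isroot (psub p b' (inl s'))
      c].
      apply: (move_atom p'Y (@move_sign _ _ c s rc _)); first by rewrite eY.
      by rewrite lelex /= !sign_labelE sE in lt' *; apply: down_setU1_le.
    (* No root is left, so the top comes next; the rank of [s'] exceeds that of [s], hence is at
       least 2. *)
    rewrite eY; exists None.
      apply/atomP=> //; right; split=> // c u; apply/negP=> /andP[rc _].
      by move/existsPn: nor => /(_ c); rewrite rc.
    rewrite /= lelex /=; have := card_down_gt0 (signs p) s.
    by rewrite -sign_labelE; lia.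
  (* The non-coherent merge of [b] with [a'] lets [a'] take the sign [s] meant for [b]. *)
  case/andP: vv' => ra' a'b'.
  apply: (move_atom p'Y (@move_sign _ _ a' s _ _)); last by rewrite lelex.
    by rewrite rE ra'; apply: contraTneq a'b' => ->; rewrite ltnn.
  apply: ok_trans (ok_sym (ok_bar o')) _; rewrite -ebb; exact: (ok_bar o).
- case: v' keep M' p'Y V' o' rE sE vv' lt =>
    [s'|[a' []]] //= keep M' p'Y V' o' rE sE vv'.
  rewrite ltlex /= => lt; case/andP: vv => ra ab; case/andP: vv' => ra' a'b'.
  have [ebb|nbb] := eqVneq b b'.
    (* Two non-coherent links of the same root compose to a coherent one. *)
    have : a' = a.
      apply: (no_coherent L) => //.
      apply: ok_trans (ok_bar (ok_sym o')) _; rewrite -ebb; exact: (ok_bar o).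
    by move=> e; rewrite e ltnn in lt.
  apply: keep; last by rewrite lelex /= ltnW.
  apply: move_merge => //; rewrite rE ?rb ?ra //.
  (* The root [a] survives because [a < a' < b']. *)
  by rewrite -val_eqE /=; move: lt a'b'; clear; lia.
- case/andP: vv => ra ab.
  have nab : a != b by apply: contraTneq ab => ->; rewrite ltnn.
  have [/andP[nab' nbb']|hit] := boolP ((a != b') && (b != b')).
    apply: keep; first by apply: move_merge => //; rewrite rE ?ra ?rb.
    by move/ltW: lt; apply: le_trans; rewrite lelex /=.
  have {}hit : b' = a \/ b' = b.
    by move: hit; rewrite negb_and !negbK => /orP[] /eqP->; auto.
  case: v' keep M' p'Y V' o' rE sE vv' lt =>
    [s'|[a' []]] //= _ M' p'Y V' o' rE sE vv' lt.
  (* The survivor [c] of [a] and [b] takes the same sign [s']. *)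
  + pose c := if b' == a then b else a.
    have [rc oc] : isroot (psub p b' (inl s')) c /\ ok Y (root_val c) (root_val
      b').
      rewrite rE /c; case: hit => e; rewrite e ?eqxx.
        by rewrite rb eq_sym nab; split=> //; rewrite /ok; case: (Y).
      by rewrite eq_sym (negbTE nab) ra nab; split=> //; apply: ok_sym.
    apply: (move_atom p'Y (move_sign rc (ok_trans oc o'))).
    by rewrite lelex /= !sign_labelE sE down_setU1_self.
  + case/andP: vv' => ra' a'b'.
    have na' : a' != b' by apply: contraTneq a'b' => ->; rewrite ltnn.
    have ra'' : isroot (psub p b' (inr (a', true))) a' by rewrite rE ra' na'.
    (* If [b'] is [a], merging [b] into [a'] non-coherently repeats the label. *)
    case: hit => e.
      apply: (move_atom p'Y (@move_merge _ _ a' b true ra'' _ _ _));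
        last by rewrite lelex /=.
      * by rewrite rE rb e eq_sym.
      * by move: a'b' ab; rewrite e; apply: ltn_trans.
      * by apply: ok_trans o _; rewrite -e.
    have ra2 : isroot (psub p b' (inr (a', true))) a by rewrite rE ra e.
    have oa : ok Y (root_val a) (inr (a', true)).
      by apply: ok_trans (ok_sym o) _; rewrite -e.
    (* Otherwise [a] is linked to the bar of [a']: the larger of the two merges into the smaller,
       and [signed_atom] covers equality. *)
    have [lta|gta|ea] := ltngtP a a'.
    * apply: (move_atom p'Y (@move_merge _ _ a a' true ra2 ra'' lta _));
        last by rewrite lelex /= ltnW.
      exact: ok_sym (ok_bar oa).
    * apply: (move_atom p'Y (@move_merge _ _ a' a true ra'' ra2 gta oa));
        by rewrite lelex /=.
    * move/val_inj: ea => ea; rewrite -ea in oa; exact: signed_atom p'Y ra2 oa.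
  (* A coherent merge with a larger label has [b < b'], so [b'] is neither [a] nor [b]. *)
  + move: lt; rewrite ltlex /= => lt; case: hit => e; move: lt;
      rewrite e ?ltnn // ltnNge (ltnW _) // ltnS ltnW.
Qed.

(** The substitution of least label gives the atom. If none is available, [Y] is the top and the
    only atom is [Y] itself. *)
Lemma lambda_least_atom (X Y : PiP) : (X < Y)%O ->
  exists m : PiP, least_atom (@lambda n d Sigma) X Y m.
Proof.
case: X => [p|] XY; last first.
  by have := lt_le_trans XY (Pi_lex1 Y); rewrite ltxx.
have pY := ltW XY.
have [/existsP[[b0 v0] /= M0]|nomove] :=
  boolP [exists bv : 'I_n * value, move Y p bv.1 bv.2]; last first.
  have nom b v : ~~ move Y p b v by move/existsPn: nomove => /(_ (b, v)).
  case: Y XY pY nom {nomove} => [q|] XY pY nom.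
    have ne : p != q by apply: contraTneq XY => ->; rewrite ltxx.
    have [b [v [V e]]] := exists_move (pY : lpart_le p q) ne.
    by have /negP[] := nom b v; rewrite /move V; apply/eqP.
  have nov b v : ~~ valid p b v by have := nom b v; rewrite /move andbT.
  have only Z : atom (Some p : PiP) None Z -> Z = None.
    case/(atomP _ pY) => [[b [v [V _ _]]]|[]//].
    by have := nov b v; rewrite V.
  exists None; split=> [|Z /only-> //|W|Z /only-> //].
    by apply/atomP => //; right.
  case/andP=> /covers_lt h _.
  by have := lt_le_trans h (Pi_lex1 W); rewrite ltxx.
have [[b v] /= M mn] := @arg_minP _ _ _ (b0, v0)
  (fun bv : 'I_n * value => move Y p bv.1 bv.2)
  (fun bv : 'I_n * value => lab p bv.1 bv.2) M0.
have L : least_move Y p b v by split=> // b' v' M'; apply: (mn (b', v')).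
have /andP[V o] := M.
have oth Z : atom (Some p : PiP) Y Z -> Z <> Some (psub p b v) ->
    exists b' v', [/\ move Y p b' v', (lab p b v < lab p b' v')%O
      & Z = Some (psub p b' v')].
  case/(atomP _ pY) => [[b' [v' [V' o' ->]]] ne|[_ _ nov] _]; last first.
    by have := nov b v; rewrite V.
  have M' : move Y p b' v' by rewrite /move V'.
  exists b', v'; split=> //; rewrite lt_neqAle (L.2 _ _ M') andbT;
    apply/eqP=> e.
  by case: ne; have [-> ->] := least_move_uniq L M' e.
exists (Some (psub p b v)); split.
- by apply/atomP => //; left; exists b, v.
- move=> Z aZ ne; have [b' [v' [/andP[V' _] lt ->]]] := oth Z aZ ne.
  by rewrite !lambda_psub.
- by move=> W aW; rewrite lambda_psub //;
    apply: (least_move_increasing pY L aW).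
- move=> Z aZ ne; have [b' [v' [M' lt ->]]] := oth Z aZ ne.
  have /andP[V' _] := M'; rewrite (lambda_psub V');
    exact: (least_move_decreasing pY L M' lt).
Qed.

End LeastMove.

Theorem theorem4p2 (n : nat) (hn : 0 < n)
    (d : Order.disp_t) (Sigma : finOrderType d) :
  EL_labeling (@lambda n d Sigma).
Proof. exact: EL_of_least_atoms (@lambda_least_atom n d Sigma). Qed.
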